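(* Let $\mathcal{A}(z)$, $A(k)$, $\lambda_A^j$ and $\mathcal{P}_{\mathcal{A}}$ be as in the context, and assume $\mathcal{P}_{\mathcal{A}}(z,\lambda)$ is irreducible. Then for every real $a\ne0$ and every $\alpha\in\mathbb{R}^d$, the set $$\{k\in\mathbb{R}^d:\ \text{there exist } s,w\in\{1,\dots,Q\} \text{ such that } \lambda_A^s(k+\alpha)=\lambda_A^w(k)+a\}$$ has Lebesgue measure zero.
   Context: Let $d,Q\ge1$ and $\mathbb{C}^\star=\mathbb{C}\setminus\{0\}$. Let $\mathcal{A}(z)$ be a $Q\times Q$ matrix each of whose entries is a Laurent polynomial in $z=(z_1,\dots,z_d)\in(\mathbb{C}^\star)^d$ with complex coefficients. Set $A(k)=\mathcal{A}(z)$ with $z_j=e^{2\pi i k_j}$, $k\in\mathbb{R}^d$, and assume $A(k)$ is Hermitian for every $k\in\mathbb{R}^d$. Denote by $\lambda_A^1(k)\le\cdots\le\lambda_A^Q(k)$ the eigenvalues of $A(k)$ in non-decreasing order. Let $\mathcal{P}_{\mathcal{A}}(z,\lambda)=\det(\mathcal{A}(z)-\lambda I_{Q\times Q})$, a Laurent polynomial in $z$ and polynomial in $\lambda$; irreducibility is meant in the ring of Laurent polynomials in $z$ with polynomial dependence on $\lambda$ (up to units). *)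

(* Defs.v *)
From HB Require Import structures.
From mathcomp Require Import all_boot all_order all_algebra.
From mathcomp Require Import all_classical all_reals all_analysis.
From mathcomp Require Import complex.
Set Implicit Arguments. Unset Strict Implicit. Unset Printing Implicit Defensive.
Import Order.TTheory GRing.Theory Num.Theory.
Local Open Scope ring_scope.
Local Open Scope classical_set_scope.

Section Defs.
Variable R : realType.
Local Notation C := R[i].

Definition laurent (d : nat) := seq (C * {ffun 'I_d -> int}).

Definition leval (d : nat) (p : laurent d) (z : 'I_d -> C) : C :=
  \sum_(t <- p) t.1 * \prod_(j < d) (z j) ^ (t.2 j).

Definition expi2pi (x : R) : C := (cos (2 * pi * x) +i* sin (2 * pi * x))%C.

Definition symb (d Q : nat) (cA : 'I_Q -> 'I_Q -> laurent d)
  (k : 'rV[R]_d) : 'M[C]_Q :=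
  \matrix_(i, j) leval (cA i j) (fun l => expi2pi (k 0 l)).

Definition hermitian_mx (Q : nat) (M : 'M[C]_Q) : Prop :=
  forall i j, M j i = (M i j)^*.

Definition sorted_eigs (Q : nat) (M : 'M[C]_Q) (l : seq R) : Prop :=
  [/\ size l = Q, sorted <=%R l &
      char_poly M = \prod_(x <- l) ('X - ((x%:C)%C)%:P)].

(* lambda^{j+1}(M): the (j+1)-th smallest eigenvalue (indices are 0-based:
   j : 'I_Q stands for j+1 in {1,...,Q}). *)
Definition eigval (Q : nat) (M : 'M[C]_Q) (j : 'I_Q) : R :=
  nth 0 (xget [::] (sorted_eigs M)) j.

(* The ring C[z_1^{+-1},...,z_d^{+-1}][lambda], realized (faithfully, by
   injectivity of evaluation) as the functions on the torus (C minus 0)^d x C of the form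
   sum c * z^m * lambda^n. *)
Definition laurentL (d : nat) := seq (C * {ffun 'I_d -> int} * nat).

Definition levalL (d : nat) (p : laurentL d) (z : 'I_d -> C) (lam : C) : C :=
  \sum_(t <- p) t.1.1 * \prod_(j < d) (z j) ^ (t.1.2 j) * lam ^+ t.2.

Definition torus (d : nat) (z : 'I_d -> C) : Prop := forall j, z j != 0.

Definition in_ringL (d : nat) (f : ('I_d -> C) -> C -> C) : Prop :=
  exists p : laurentL d, forall z, torus z -> forall lam, f z lam = levalL p z lam.

Definition eqL (d : nat) (f g : ('I_d -> C) -> C -> C) : Prop :=
  forall z, torus z -> forall lam, f z lam = g z lam.

Definition unitL (d : nat) (f : ('I_d -> C) -> C -> C) : Prop :=
  in_ringL f /\ exists g, in_ringL g /\ eqL (fun z lam => f z lam * g z lam) (fun _ _ => 1).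

Definition irreducibleL (d : nat) (f : ('I_d -> C) -> C -> C) : Prop :=
  [/\ in_ringL f, ~ unitL f &
      forall g h, in_ringL g -> in_ringL h ->
        eqL f (fun z lam => g z lam * h z lam) -> unitL g \/ unitL h].

Definition charP (d Q : nat) (cA : 'I_Q -> 'I_Q -> laurent d)
  : ('I_d -> C) -> C -> C :=
  fun z lam => \det (\matrix_(i, j) leval (cA i j) z - lam%:M).

Definition box (d : nat) (lo hi : 'rV[R]_d) : set 'rV[R]_d :=
  [set x | forall j, lo 0 j <= x 0 j <= hi 0 j].

Definition lebesgue_null (d : nat) (S : set 'rV[R]_d) : Prop :=
  forall eps : R, 0 < eps ->
    exists lo hi : nat -> 'rV[R]_d,
      [/\ forall n j, lo n 0 j <= hi n 0 j,
          S `<=` \bigcup_n box (lo n) (hi n) &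
          forall N, \sum_(n < N) \prod_(j < d) (hi n 0 j - lo n 0 j) <= eps].

End Defs.

(* Main.v *)
Require Import Defs.
From HB Require Import structures.
From mathcomp Require Import all_boot all_order all_algebra.
From mathcomp Require Import all_classical all_reals all_analysis.
From mathcomp Require Import complex ring lra zify.
Import Order.TTheory GRing.Theory Num.Theory.
Import Normc numFieldNormedType.Exports.
Local Open Scope ring_scope.
Local Open Scope classical_set_scope.

(* With mu_j = e^(2 pi i alpha_j), the polynomials P(z, lambda) and P(mu z, lambda + a) have a
   common root lambda whenever z = e^(2 pi i k) with k in the exceptional set, so their
   resultant in lambda, a Laurent polynomial in z, vanishes there. If it is not identically
   zero, its zero set is null. Otherwise the two polynomials share a factor; by unique
   factorization the irreducible P is prime, and since both are monic of degree Q in lambda up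
   to the same sign they coincide. Comparing traces, tr A(k + alpha) = tr A(k) + Q a for all k,
   which contradicts the boundedness of tr A.

   The zeros on the real torus of a nonzero polynomial p are null by induction on the number of
   variables and the degree in the last one: they are either zeros of the derivative p' in that
   variable, or lie on countably many sets that are locally Lipschitz graphs. *)

Set Implicit Arguments. Unset Strict Implicit. Unset Printing Implicit Defensive.

(** * Unique factorization *)

Definition divides (A : idomainType) (p x : A) : Prop := exists c, x = c * p.

Definition prime_elt (A : idomainType) (p : A) : Prop :=
  [/\ p != 0, p \isn't a GRing.unit &
      forall x y, divides p (x * y) -> divides p x \/ divides p y].

(** Asking for primes rather than irreducibles makes bare existence enough: a factorization into
    primes is automatically unique up to units. *)
Definition is_ufd (A : idomainType) : Prop :=
  forall x : A, x != 0 -> exists u s,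
    [/\ u \is a GRing.unit, forall q, q \in s -> prime_elt q &
        x = u * \prod_(q <- s) q].

Lemma dividesM (A : idomainType) (p x y : A) : divides p x -> divides p (x * y).
Proof. by case=> c ->; exists (c * y); rewrite mulrAC. Qed.

Lemma dividesMr (A : idomainType) (p x y : A) : divides p y -> divides p (x * y).
Proof. by rewrite mulrC; apply: dividesM. Qed.

Lemma dividesD (A : idomainType) (p x y : A) :
  divides p x -> divides p y -> divides p (x + y).
Proof. by move=> [c ->] [c' ->]; exists (c + c'); rewrite mulrDl. Qed.

Lemma dividesDr (A : idomainType) (p x y : A) :
  divides p x -> divides p (x + y) -> divides p y.
Proof. by move=> [c ->] [c' e]; exists (c' - c); rewrite mulrBl -e addrAC subrr add0r. Qed.

Lemma prime_divides_prod (A : idomainType) (p u : A) (s : seq A) :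
  prime_elt p -> u \is a GRing.unit -> divides p (u * \prod_(q <- s) q) ->
  exists2 q, q \in s & divides p q.
Proof.
move=> [p0 pnu pP] uu; elim: s => [|q s IHs].
  rewrite big_nil mulr1 => -[c uE]; move: pnu.
  by rewrite uE unitrM in uu; case/andP: uu => _ ->.
rewrite big_cons mulrCA => /pP[pq|/IHs[q' q's pq']].
  by exists q => //; rewrite mem_head.
by exists q' => //; rewrite inE q's orbT.
Qed.

(** [p] divides some [q] in [s]; both being prime, they are associates, so [q] is struck from the
    list and their quotient joins the unit. The strict drop in length drives the induction in
    [primitive_part]. *)
Lemma cancel_prime (A : idomainType) (p x u : A) (s : seq A) :
  prime_elt p -> u \is a GRing.unit -> (forall q, q \in s -> prime_elt q) ->
  p * x = u * \prod_(q <- s) q ->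
  exists v t, [/\ v \is a GRing.unit, (size t < size s)%N,
     forall q, q \in t -> prime_elt q & x = v * \prod_(q <- t) q].
Proof.
move=> pp uu sP xE.
have [q qs [c qE]] : exists2 q, q \in s & divides p q.
  by apply: prime_divides_prod pp uu _; rewrite -xE; exists x; rewrite mulrC.
have [q0 qnu qP] := sP q qs; have [p0 pnu _] := pp.
have cu : c \is a GRing.unit.
  have [|[e cE]|[e pE]] := qP c p; first by exists 1; rewrite mul1r.
    have : 1 * q = (e * p) * q by rewrite mul1r {1}qE {1}cE mulrAC.
    move/(mulIf q0)/esym => ep1; case/negP: pnu.
    by apply/unitrPr; exists e; rewrite mulrC.
  have : 1 * p = (e * c) * p by rewrite mul1r -mulrA -qE.
  by move/(mulIf p0)/esym => ec1; apply/unitrPr; exists e; rewrite mulrC.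
exists (u * c), (rem q s); split.
- by rewrite unitrM uu.
- by rewrite size_rem // prednK // ; case: (s) qs.
- by move=> r /mem_rem; apply: sP.
- apply: (mulfI p0); rewrite xE (perm_big _ (perm_to_rem qs)) big_cons /= {1}qE.
  by ring.
Qed.

Lemma divides_coef (A : idomainType) (p : A) (f : {poly A}) :
  divides p%:P f <-> forall i, divides p f`_i.
Proof.
split=> [[c ->] i|pf]; first by exists c`_i; rewrite coefMC.
elim/poly_ind: f pf => [|f c IHf] pf; first by exists 0; rewrite mul0r.
apply: dividesD.
  apply: dividesM; apply: IHf => i; have := pf i.+1.
  by rewrite coefD coefMX coefC addr0.
have := pf 0%N; rewrite coefD coefMX coefC add0r => -[e ->].
by exists e%:P; rewrite -polyCM.
Qed.

Lemma divides_mulX (A : idomainType) (p : A) (f : {poly A}) :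
  divides p%:P (f * 'X) -> divides p%:P f.
Proof.
by move=> /divides_coef pf; apply/divides_coef => i; have := pf i.+1; rewrite coefMX.
Qed.

(** Constant terms are peeled off: [p] divides [a * b], hence [a] or [b]. Subtracting the multiple
    of [p] so obtained leaves a multiple of ['X], and cancelling ['X] gives a product with one
    shorter factor. *)
Lemma prime_polyC (A : idomainType) (p : A) : prime_elt p -> prime_elt p%:P.
Proof.
move=> [p0 pnu pP]; split; first by rewrite polyC_eq0.
  by rewrite poly_unitE size_polyC p0 coefC.
elim/poly_ind=> [|f a IHf] g; first by left; exists 0; rewrite mul0r.
elim/poly_ind: g => [|g b IHg]; first by right; exists 0; rewrite mul0r.
move=> H.
have pab : divides p (a * b).
  move/divides_coef/(_ 0%N): H.
  by rewrite coef0M !coefD !coefMX !coefC !add0r.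
have pC c : divides p c -> divides p%:P c%:P.
  by case=> e ->; exists e%:P; rewrite -polyCM.
case/pP: pab => [/pC pa|/pC pb].
- have : divides p%:P (f * (g * 'X + b%:P)).
    apply: divides_mulX; apply: (@dividesDr _ _ (a%:P * (g * 'X + b%:P))).
      exact: dividesM.
    by rewrite mulrAC -mulrDl addrC.
  case/IHf=> [pf|]; last by right.
  by left; apply: dividesD => //; apply: dividesM.
- have : divides p%:P ((f * 'X + a%:P) * g).
    apply: divides_mulX; apply: (@dividesDr _ _ ((f * 'X + a%:P) * b%:P)).
      exact: dividesMr.
    by rewrite -mulrA -mulrDr [b%:P + _]addrC.
  case/IHg=> [|pg]; first by left.
  by right; apply: dividesD => //; apply: dividesM.
Qed.

Definition primitive (A : idomainType) (f : {poly A}) : Prop :=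
  forall p, prime_elt p -> ~ divides p%:P f.

(** Pulling prime constants out of [f] terminates because each one removes a prime factor from the
    leading coefficient. *)
Lemma primitive_part (A : idomainType) (f : {poly A}) :
  is_ufd A -> f != 0 -> exists c g, [/\ c != 0, primitive g & f = c%:P * g].
Proof.
move=> fA f0.
have /fA[u [s [uu sP]]] : lead_coef f != 0 by rewrite lead_coef_eq0.
have [n] := ubnP (size s); elim: n f f0 u s uu sP => // n IHn f f0 u s uu sP sn fE.
have [fprim|] := pselect (primitive f).
  by exists 1, f; rewrite oner_eq0 mul1r.
move=> /existsNP[p /not_implyP[pp /contrapT[g gE]]].
have p0 : p != 0 by case: pp.
have g0 : g != 0 by apply: contra_neq f0 => g0; rewrite gE g0 mul0r.
have [|v [t [vu ts tP gtE]]] := @cancel_prime _ p (lead_coef g) u s pp uu sP.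
  by rewrite -fE gE lead_coefM lead_coefC mulrC.
have [|c [h [c0 hprim hE]]] := IHn g g0 v t vu tP _ gtE.
  exact: leq_trans ts _.
exists (p * c), h; split=> //; first by rewrite mulf_neq0.
by rewrite gE hE polyCM -mulrA mulrC.
Qed.

(** A form of Gauss' lemma. The prime factors of [c] are cancelled one at a time: each stays prime
    as a constant polynomial and does not divide the primitive [q], so it divides the cofactor
    [w]. *)
Lemma primitive_cancel (A : idomainType) (q y : {poly A}) (c : A) :
  is_ufd A -> primitive q -> c != 0 -> divides q (c%:P * y) -> divides q y.
Proof.
move=> fA qprim c0 [w].
have [u [s [uu sP cE]]] := fA c c0.
have : c = (\prod_(q <- s) q) * u by rewrite mulrC.
move: {c0} c {cE} => c cE; elim: s sP c cE w => [|p s IHs] sP c.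
  rewrite big_nil mul1r => -> w e; exists (u^-1%:P * w).
  by rewrite -mulrA -e mulrA -polyCM mulVr // mul1r.
rewrite big_cons -mulrA => -> w e.
have pp : prime_elt p by apply: sP; rewrite mem_head.
have [pC0 _ pCP] := prime_polyC pp.
have [|[w' wE]|/(qprim _ pp)//] := pCP w q.
  by rewrite -e polyCM -mulrA mulrC; exists (((\prod_(q <- s) q) * u)%:P * y).
apply: (IHs _ _ erefl w') => [r rs|]; first by apply: sP; rewrite inE rs orbT.
  by apply: (mulfI pC0); rewrite [LHS]mulrA -polyCM e wE [w' * _]mulrC mulrA.
Qed.

(* A primitive polynomial of minimal positive degree among the divisors of [f] over the
   fraction field is irreducible there, hence prime by Bezout and Gauss' lemma. *)
Lemma prime_factor_poly (A : idomainType) (f : {poly A}) :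
  is_ufd A -> (1 < size f)%N ->
  exists q : {poly A}, [/\ prime_elt q, (1 < size q)%N & divides q f].
Proof.
move=> fA sf.
pose P n := `[< exists q : {poly A}, [/\ q %| f, (1 < size q)%N & size q = n] >].
have exP : exists n, P n by exists (size f); apply/asboolP; exists f; rewrite dvdpp.
case: (ex_minnP exP) => n /asboolP[q1 [q1f sq1 q1E]] nmin.
have f0 : f != 0 by rewrite -size_poly_gt0; case: (size f) sf.
have q1n0 : q1 != 0 by rewrite -size_poly_gt0; case: (size q1) sq1.
have [c [q [c0 qprim qE]]] := primitive_part fA q1n0.
have sqn : size q = n by rewrite -q1E qE mul_polyC size_scale.
have sq : (1 < size q)%N by rewrite sqn -q1E.
have qf : q %| f by apply: dvdp_trans q1f; rewrite qE dvdp_mull.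
have qn0 : q != 0 by rewrite -size_poly_gt0; case: (size q) sq.
have dvdpW g : q %| g -> divides q g.
  move=> /Pdiv.Idomain.dvdpP[[b h] /= b0 e]; apply: primitive_cancel qprim b0 _ => //.
  by exists h; rewrite mul_polyC.
exists q; split=> //; last exact: dvdpW.
split=> //; first by rewrite poly_unitE eqn_leq leqNgt sq.
move=> x y [w xyE].
have [sg|sg] := leqP (size (gcdp q x)) 1; last first.
  (* A gcd of positive degree is itself a candidate for the minimum, so it has the degree of [q] and
     is associate to it over the fraction field. *)
  left; apply: dvdpW; apply: dvdp_trans (dvdp_gcdr q x).
  have := dvdp_gcdl q x => gq; have := dvdp_size_eqp gq.
  rewrite eqn_leq (dvdp_leq qn0 gq) /= sqn nmin => [/esym/andP[]//|].
  by apply/asboolP; exists (gcdp q x); split=> //; apply: dvdp_trans qf.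
(* The gcd is now a nonzero constant [b]. Multiplying the Bezout relation by [y] and replacing
   [x * y] by [w * q] makes a nonzero constant multiple of [y] a multiple of [q]. *)
right; have [[u v] /= e] := Bezoutp q x.
have /size_poly1P[b b0 gE] : size (gcdp q x) == 1.
  by rewrite eqn_leq sg size_poly_gt0 gcdp_eq0 negb_and qn0.
move: e; rewrite gE => /eqpP[[c1 c2] /= /andP[c10 c20]] e.
apply: (@primitive_cancel _ _ _ (c2 * b)) => //; first by rewrite mulf_neq0.
exists (c1%:P * (u * y + v * w)).
rewrite polyCM -(mul_polyC c2) -(mul_polyC c1) in e *; rewrite -e.
have -> : c1%:P * (u * y + v * w) * q = c1%:P * (u * y * q + v * (w * q)) by ring.
by rewrite -xyE; ring.
Qed.

Lemma is_ufd_poly (A : idomainType) : is_ufd A -> is_ufd {poly A}.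
Proof.
move=> fA f; have [n] := ubnP (size f); elim: n f => // n IHn f sn f0.
have [s1|s2] := leqP (size f) 1.
  have /size_poly1P[c c0 ->] : size f == 1 by rewrite eqn_leq s1 size_poly_gt0.
  have [u [s [uu sP ->]]] := fA c c0.
  exists u%:P, [seq q%:P | q <- s]; split.
  - have u0 : u != 0 by apply: contraTneq uu => ->; rewrite unitr0.
    by rewrite poly_unitE size_polyC coefC u0 uu.
  - by move=> _ /mapP[q /sP qs ->]; apply: prime_polyC.
  - by rewrite big_map polyCM rmorph_prod.
have [q [qp sq [g gE]]] := prime_factor_poly fA s2.
have g0 : g != 0 by apply: contra_neq f0 => g0; rewrite gE g0 mul0r.
have [|u [s [uu sP gsE]]] := IHn g _ g0.
  have := sn; rewrite gE size_mul //; last by case: qp.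
  have := size_poly_gt0 g; rewrite g0; lia.
exists u, (q :: s); split=> //.
  by move=> r; rewrite inE => /orP[/eqP->//|/sP].
by rewrite gE gsE big_cons mulrCA mulrC mulrA.
Qed.

Lemma is_ufd_field (F : fieldType) : is_ufd F.
Proof.
move=> x x0; exists x, [::]; split=> //; first by rewrite unitfE.
by rewrite big_nil mulr1.
Qed.

(** * Laurent polynomials as iterated polynomials *)

(** The last variable is outermost, so that [mpring F d.+1] is literally the ring of polynomials in
    the spectral parameter over the polynomials in the d coordinates. *)
Fixpoint mpring (F : fieldType) (n : nat) : idomainType :=
  if n is n'.+1 then GRing.IntegralDomain.clone {poly mpring F n'} _
  else F : idomainType.

Fixpoint mpeval (F : fieldType) (z : nat -> F) (n : nat) : {rmorphism mpring F n -> F} :=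
  if n is n'.+1 then horner_eval (z n') \o map_poly (mpeval z n') else idfun.

Lemma is_ufd_mpring (F : fieldType) (n : nat) : is_ufd (mpring F n).
Proof. by elim: n => [|n IHn] /=; [apply: is_ufd_field | apply: is_ufd_poly]. Qed.

Lemma mpevalS (F : fieldType) (z : nat -> F) n (p : {poly mpring F n}) :
  mpeval z n.+1 p = (map_poly (mpeval z n) p).[z n].
Proof. by []. Qed.

Lemma mpeval_ext (F : fieldType) (z w : nat -> F) n (p : mpring F n) :
  (forall i, (i < n)%N -> z i = w i) -> mpeval z n p = mpeval w n p.
Proof.
elim: n p => [//|n IHn] p zw; rewrite !mpevalS zw //; congr (_ .[_]).
by apply: eq_map_poly => c; apply: IHn => i ilt; apply: zw; rewrite ltnW.
Qed.

Lemma poly_eq0_off0 (F : numFieldType) (p : {poly F}) :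
  (forall x, x != 0 -> p.[x] = 0) -> p = 0.
Proof.
move=> p0; apply/eqP; apply: contraT => pn0.
pose s := [seq i.+1%:R | i <- iota 0 (size p)] : seq F.
have /max_poly_roots : all (root p) s.
  by apply/allP => _ /mapP[i _ ->]; rewrite rootE p0 // pnatr_eq0.
move=> /(_ pn0); rewrite size_map size_iota ltnn => -> //.
by rewrite map_inj_uniq ?iota_uniq // => i j /eqP; rewrite eqr_nat => /eqP[].
Qed.

(** Testing on the torus suffices because a one-variable polynomial vanishing at all nonzero points
    is zero; applied in the last variable, this kills each coefficient on the torus. *)
Lemma mpeval_eq0 (F : numFieldType) n (p : mpring F n) :
  (forall z : nat -> F, (forall i, z i != 0) -> mpeval z n p = 0) -> p = 0.
Proof.
elim: n p => [|n IHn] p p0.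
  by have := p0 (fun=> 1) (fun=> oner_neq0 _).
apply/polyP => i; rewrite coef0; apply: IHn => z z0.
have /polyP/(_ i) : map_poly (mpeval z n) p = 0.
  apply: poly_eq0_off0 => x x0.
  rewrite -[RHS](p0 (fun j => if j == n then x else z j)) => [|j]; last by case: ifP.
  rewrite mpevalS eqxx; congr (_ .[_]); apply: eq_map_poly => c.
  by apply: mpeval_ext => j; case: (ltngtP j n).
by rewrite coef_map coef0.
Qed.

Fixpoint mpcst (F : fieldType) (n : nat) (c : F) : mpring F n :=
  if n is n'.+1 return mpring F n then (mpcst n' c)%:P else c.

(* Junk value 0 when [n <= i]. *)
Fixpoint mpvar (F : fieldType) (n i : nat) : mpring F n :=
  if n is n'.+1 return mpring F n then
    if i == n' then 'X else (mpvar F n' i)%:P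
  else 0.

Lemma mpeval_cst (F : fieldType) (z : nat -> F) n c : mpeval z n (mpcst n c) = c.
Proof. by elim: n => [//|n IHn]; rewrite mpevalS /= map_polyC hornerC. Qed.

Lemma mpeval_var (F : fieldType) (z : nat -> F) n i : (i < n)%N ->
  mpeval z n (mpvar F n i) = z i.
Proof.
elim: n => [//|n IHn]; rewrite mpevalS /= ltnS leq_eqVlt.
have [->|_ /= /IHn] := eqVneq i n; first by rewrite map_polyX hornerX.
by rewrite map_polyC hornerC.
Qed.

(* Transparent, [mpeval z n.+1] unifies with a composition, which derails the rewriting with
   morphism lemmas. *)
Opaque mpeval mpcst mpvar.

(* The coordinates z_0, ..., z_(d-1), followed by the spectral parameter at index d. *)
Definition fext (F : Type) (d : nat) (z : 'I_d -> F) (lam : F) (i : nat) : F :=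
  if insub i is Some j then z j else lam.

Lemma fext_ord (F : Type) d (z : 'I_d -> F) lam (j : 'I_d) : fext z lam j = z j.
Proof. by rewrite /fext valK. Qed.

Lemma fext_lam (F : Type) d (z : 'I_d -> F) lam i : (d <= i)%N -> fext z lam i = lam.
Proof. by move=> di; rewrite /fext insubF // ltnNge di. Qed.

(** * Passage between Laurent polynomials and ordinary polynomials *)

Lemma in_ringL_eq (R : realType) d (f g : ('I_d -> R[i]) -> R[i] -> R[i]) :
  eqL f g -> in_ringL f -> in_ringL g.
Proof. by move=> fg [p fp]; exists p => z tz lam; rewrite -fg // fp. Qed.

Lemma in_ringL0 (R : realType) d : @in_ringL R d (fun _ _ => 0).
Proof. by exists [::] => z _ lam; rewrite /levalL big_nil. Qed.

Lemma in_ringL_cst (R : realType) d c : @in_ringL R d (fun _ _ => c).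
Proof.
exists [:: (c, [ffun=> 0], 0%N)] => z _ lam; rewrite /levalL big_seq1 /=.
by rewrite big1 ?mulr1 ?expr0 ?mulr1 // => j _; rewrite ffunE expr0z.
Qed.

Lemma in_ringLD (R : realType) d (f g : ('I_d -> R[i]) -> R[i] -> R[i]) :
  in_ringL f -> in_ringL g -> in_ringL (fun z lam => f z lam + g z lam).
Proof.
move=> [p fp] [q gq]; exists (p ++ q) => z tz lam.
by rewrite fp // gq // /levalL big_cat.
Qed.

Lemma in_ringL_monoM (R : realType) d (c : R[i]) (e : {ffun 'I_d -> int}) n
    (f : ('I_d -> R[i]) -> R[i] -> R[i]) :
  in_ringL f ->
  in_ringL (fun z lam => c * \prod_(j < d) z j ^ e j * lam ^+ n * f z lam).
Proof.
move=> [p fp].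
exists [seq (c * t.1.1, [ffun j => e j + t.1.2 j], (n + t.2)%N)
       | t : R[i] * {ffun 'I_d -> int} * nat <- p] => z tz lam.
rewrite fp // /levalL big_map mulr_sumr; apply: eq_bigr => -[[c' e'] n'] _ /=.
under [X in _ = _ * X * _]eq_bigr => j _ do rewrite ffunE expfzDr ?tz //.
by rewrite big_split exprD /=; ring.
Qed.

Lemma in_ringL_coordM (R : realType) d (f : ('I_d -> R[i]) -> R[i] -> R[i]) i :
  in_ringL f -> in_ringL (fun z lam => fext z lam i * f z lam).
Proof.
move=> fr; have [id|di] := ltnP i d; last first.
  apply: in_ringL_eq (in_ringL_monoM 1 [ffun=> 0] 1 fr) => z tz lam.
  rewrite fext_lam // big1 ?mulr1 ?expr1 ?mul1r // => j _.
  by rewrite ffunE expr0z.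
pose j0 := Ordinal id.
apply: in_ringL_eq (in_ringL_monoM 1 [ffun j => (j == j0)%:Z] 0 fr) => z tz lam.
rewrite -[X in fext z lam X]/(val j0) fext_ord (bigD1 j0) //= ffunE eqxx big1.
  by rewrite expr0 !mulr1 mul1r.
by move=> j /negbTE jj; rewrite ffunE jj expr0z.
Qed.

Lemma in_ringL_mpeval (R : realType) d n (p : mpring R[i] n) :
  @in_ringL R d (fun z lam => mpeval (fext z lam) n p).
Proof.
elim: n p => [|n IHn] p; first exact: in_ringL_cst.
elim/poly_ind: p => [|p c IHp].
  by apply: in_ringL_eq (in_ringL0 _ _) => z tz lam; rewrite rmorph0.
apply: in_ringL_eq (in_ringLD (in_ringL_coordM n IHp) (IHn c)) => z tz lam.
by rewrite !mpevalS rmorphD rmorphM /= map_polyX map_polyC hornerMXaddC mulrC.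
Qed.

(** Clears denominators: a high enough power of the product of the coordinates makes all exponents
    nonnegative. *)
Lemma in_ringL_clear (R : realType) d (f : ('I_d -> R[i]) -> R[i] -> R[i]) :
  in_ringL f -> exists M (p : mpring R[i] d.+1), forall z, torus z -> forall lam,
    f z lam * (\prod_j z j) ^+ M = mpeval (fext z lam) d.+1 p.
Proof.
move=> [p fp].
suff [M [q qP]] : exists M (q : mpring R[i] d.+1), forall z, torus z -> forall lam,
    levalL p z lam * (\prod_j z j) ^+ M = mpeval (fext z lam) d.+1 q.
  by exists M, q => z tz lam; rewrite fp // qP.
elim: p {f fp} => [|[[c e] n] p [M [q qP]]].
  by exists 0%N, 0 => z tz lam; rewrite /levalL big_nil mul0r rmorph0.
pose N := (\sum_j `|e j|)%N.
have eN j : 0 <= e j + N%:Z.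
  have : (`|e j| <= N)%N by rewrite /N (bigD1 j) //= leq_addr.
  lia.
pose v i := mpvar R[i] d.+1 i.
(* The new term needs the power [N], the remaining sum the power [M]; each is multiplied by the
   other's power to reach the common exponent. *)
exists (N + M)%N, (mpcst d.+1 c * (\prod_(j < d) v j ^+ `|(e j + N%:Z)%R|%N) * v d ^+ n
   * (\prod_(j < d) v j) ^+ M + q * (\prod_(j < d) v j) ^+ N) => z tz lam.
rewrite rmorphD !rmorphM !rmorphXn !rmorph_prod mpeval_cst.
have vE (j : 'I_d) : mpeval (fext z lam) d.+1 (v j) = z j.
  by rewrite /v mpeval_var ?fext_ord // ltnS ltnW.
have prodvE : \prod_(j < d) mpeval (fext z lam) d.+1 (v j) = \prod_j z j.
  by apply: eq_bigr => j _; rewrite vE.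
have prodeE : \prod_(j < d) mpeval (fext z lam) d.+1 (v j ^+ `|(e j + N%:Z)%R|%N)
    = (\prod_(j < d) z j ^ e j) * (\prod_j z j) ^+ N.
  rewrite -prodrXl -big_split; apply: eq_bigr => j _ /=.
  by rewrite rmorphXn vE exprnP gez0_abs // expfzDr ?tz.
rewrite -qP // prodvE prodeE /v mpeval_var // fext_lam //.
rewrite /levalL big_cons /= exprD; ring.
Qed.

(** Puts P(mu z, lambda + a) in the ring: rescaling the coordinates only changes the coefficient of
    a monomial, and powers of [lam + a] expand in powers of [lam]. *)
Lemma in_ringL_shift (R : realType) d (f : ('I_d -> R[i]) -> R[i] -> R[i])
    (mu : 'I_d -> R[i]) (a : R[i]) : torus mu ->
  in_ringL f -> in_ringL (fun z lam => f (fun j => mu j * z j) (lam + a)).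
Proof.
move=> tmu [p fp].
have : in_ringL (fun z lam => levalL p (fun j => mu j * z j) (lam + a)).
  elim: p {fp} => [|[[c e] n] p IHp].
    by apply: in_ringL_eq (in_ringL0 _ _) => z tz lam; rewrite /levalL big_nil.
  have in_pow : @in_ringL R d (fun z lam => (lam + a) ^+ n).
    elim: n => [|n IHn]; first exact: in_ringL_cst.
    apply: in_ringL_eq (in_ringLD (in_ringL_coordM d IHn)
      (in_ringL_monoM a [ffun=> 0] 0 IHn)) => z tz lam.
    rewrite fext_lam // big1 => [|j _]; last by rewrite ffunE expr0z.
    by rewrite exprS expr0; ring.
  apply: in_ringL_eq (in_ringLD
    (in_ringL_monoM (c * \prod_(j < d) mu j ^ e j) e 0 in_pow) IHp) => z tz lam.
  rewrite /levalL big_cons /= expr0 mulr1; congr (_ * _ + _).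
  by rewrite -mulrA -big_split /=; congr (_ * _); apply: eq_bigr => j _; rewrite expfzMl.
apply: in_ringL_eq => z tz lam; rewrite fp // => j.
by rewrite mulf_neq0.
Qed.

Lemma mpeval_inj_torus (R : realType) d n (p q : mpring R[i] n) : (n <= d.+1)%N ->
  (forall z : 'I_d -> R[i], torus z -> forall lam,
     mpeval (fext z lam) n p = mpeval (fext z lam) n q) -> p = q.
Proof.
move=> nd pq; apply/eqP; rewrite -subr_eq0; apply/eqP; apply: mpeval_eq0 => z z0.
have zE i : (i < n)%N -> z i = fext (fun j : 'I_d => z j) (z d) i.
  rewrite /fext; case: insubP => [j _ -> //|]; rewrite -leqNgt => di il.
  by congr z; apply/eqP; rewrite eqn_leq di -ltnS (leq_trans il).
by rewrite rmorphB !(mpeval_ext _ zE) pq ?subrr // => j.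
Qed.

Definition mpmon (F : fieldType) (d : nat) : mpring F d := \prod_(j < d) mpvar F d j.

Lemma mpeval_mon (F : fieldType) d (z : 'I_d -> F) lam :
  mpeval (fext z lam) d (mpmon F d) = \prod_j z j.
Proof.
by rewrite rmorph_prod; apply: eq_bigr => j _; rewrite mpeval_var // fext_ord.
Qed.

Lemma mpmon_neq0 (F : fieldType) d : mpmon F d != 0.
Proof.
apply/eqP => m0; have := mpeval_mon (fun _ : 'I_d => 1 : F) 1.
by rewrite m0 rmorph0 big1 // => /esym/eqP; rewrite oner_eq0.
Qed.

Lemma prod_torus_neq0 (R : realType) d (z : 'I_d -> R[i]) : torus z -> \prod_j z j != 0.
Proof. by move=> tz; apply/prodf_neq0 => j _; apply: tz. Qed.

Lemma mpevalS_fext (F : fieldType) d (z : 'I_d -> F) lam mu (p : {poly mpring F d}) :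
  mpeval (fext z lam) d.+1 p = (map_poly (mpeval (fext z mu) d) p).[lam].
Proof.
rewrite mpevalS fext_lam //; congr (_ .[_]); apply: eq_map_poly => c.
by apply: mpeval_ext => i id; rewrite (_ : i = Ordinal id :> nat) // !fext_ord.
Qed.

(** Coefficients are identified by their values on the torus, where [p] specializes to a monomial
    power times a monic polynomial. *)
Lemma clear_monic (R : realType) d Q M (chi : ('I_d -> R[i]) -> {poly R[i]})
    (p : {poly mpring R[i] d}) :
  (forall z, chi z \is monic) -> (forall z, size (chi z) = Q.+1) ->
  (forall z, torus z -> forall lam,
     (chi z).[lam] * (\prod_j z j) ^+ M = mpeval (fext z lam) d.+1 p) ->
  size p = Q.+1 /\ lead_coef p = mpmon R[i] d ^+ M.
Proof.
move=> mchi schi pE.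
have mapE z lam : torus z ->
    map_poly (mpeval (fext z lam) d) p = (\prod_j z j) ^+ M *: chi z.
  move=> tz; apply/eqP; rewrite -subr_eq0; apply/eqP; apply: poly_eq0_off0 => x x0.
  by rewrite hornerD hornerN hornerZ -mpevalS_fext -pE // mulrC subrr.
have coefE z lam i : torus z ->
    mpeval (fext z lam) d p`_i = (\prod_j z j) ^+ M * (chi z)`_i.
  by move=> tz; rewrite -coef_map mapE // coefZ.
have pQ : p`_Q = mpmon R[i] d ^+ M.
  apply: (@mpeval_inj_torus _ d) => // z tz lam; rewrite coefE // rmorphXn mpeval_mon.
  by have /monicP := mchi z; rewrite lead_coefE schi /= => ->; rewrite mulr1.
have sp : (size p <= Q.+1)%N.
  apply/leq_sizeP => i Qi; apply: (@mpeval_inj_torus _ d) => // z tz lam.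
  by rewrite coefE // nth_default ?schi // mulr0 rmorph0.
have m0 : mpmon R[i] d ^+ M != 0 by rewrite expf_neq0 ?mpmon_neq0.
have -> : size p = Q.+1.
  apply/eqP; rewrite eqn_leq sp /= ltnNge; apply: contra m0 => sQ.
  by rewrite -pQ nth_default.
split=> //; rewrite lead_coefE -pQ; congr (_`_ _).
apply/eqP; rewrite -eqSS prednK; first last.
  by rewrite lt0n size_poly_eq0; apply: contra m0 => /eqP p0; rewrite -pQ p0 coef0.
rewrite eqn_leq sp ltnNge; apply: contra m0 => sQ.
by rewrite -pQ nth_default.
Qed.

(** Units have degree 0 in lambda: once the inverse is cleared of denominators, the product is a
    monomial free of lambda, and degrees add. *)
Lemma size_unit_mpeval (R : realType) d (q : {poly mpring R[i] d})
    (h : ('I_d -> R[i]) -> R[i] -> R[i]) :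
  in_ringL h -> eqL (fun z lam => mpeval (fext z lam) d.+1 q * h z lam) (fun _ _ => 1) ->
  size q = 1%N.
Proof.
move=> /in_ringL_clear[M [h' hE]] qh1.
have qhE : q * h' = (mpmon R[i] d ^+ M)%:P.
  apply: (@mpeval_inj_torus _ d d.+1) => // z tz lam.
  rewrite rmorphM -hE // mulrA qh1 // mul1r (mpevalS_fext _ _ 0) map_polyC hornerC.
  by rewrite /= rmorphXn mpeval_mon.
have m0 : mpmon R[i] d ^+ M != 0 by rewrite expf_neq0 ?mpmon_neq0.
have : size (q * h') == 1%N by rewrite qhE size_polyC m0.
by rewrite size_mul_eq1 => /andP[/eqP].
Qed.

(** A prime factor [q] of positive degree in lambda is no Laurent unit, so irreducibility makes the
    cofactor [r] one. As [r] may contain coordinate monomials, it is controlled only through its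
    degree in lambda. *)
Lemma irreducibleL_prime (R : realType) d M (f : ('I_d -> R[i]) -> R[i] -> R[i])
    (p : {poly mpring R[i] d}) :
  irreducibleL f -> (1 < size p)%N ->
  (forall z, torus z -> forall lam,
     f z lam * (\prod_j z j) ^+ M = mpeval (fext z lam) d.+1 p) ->
  exists (q r : {poly mpring R[i] d}), [/\ prime_elt q, p = r * q & size r = 1%N].
Proof.
move=> [_ _ fI] sp pE.
have [q [qp sq [r rE]]] := prime_factor_poly (@is_ufd_mpring R[i] d) sp.
exists q, r; split=> //.
pose g := fun z lam => mpeval (@fext R[i] d z lam) d.+1 q.
(* The inverse of the clearing monomial, attached to [r] so that the factorization of [p] becomes
   one of [f] itself. *)
pose iM := fun z : 'I_d -> R[i] => \prod_(j < d) z j ^ ([ffun=> - M%:Z] : {ffun 'I_d -> int}) j.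
have iME z : torus z -> iM z = (\prod_j z j) ^- M.
  move=> tz; rewrite -prodrXl -prodfV; apply: eq_bigr => j _.
  by rewrite ffunE exprnN.
have in_iM h : in_ringL h -> in_ringL (fun z lam => iM z * h z lam).
  move=> hr; apply: in_ringL_eq (in_ringL_monoM 1 [ffun=> - M%:Z] 0 hr) => z tz lam.
  by rewrite mul1r mulr1.
have [| | | |] := fI g (fun z lam => iM z * mpeval (fext z lam) d.+1 r).
- exact: in_ringL_mpeval.
- by apply: in_iM; apply: in_ringL_mpeval.
- move=> z tz lam; have := pE z tz lam; rewrite {1}rE rmorphM => fE.
  rewrite /g mulrCA [X in _ = _ * X]mulrC -fE iME // mulrCA mulVf ?mulr1 //.
  by rewrite expf_neq0 // prod_torus_neq0.
- move=> [_ [h [hr gh]]]; have := size_unit_mpeval hr gh => s1.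
  by rewrite s1 in sq.
- move=> [_ [h [hr gh]]]; apply: size_unit_mpeval (in_iM _ hr) _ => z tz lam.
  by rewrite -[RHS](gh z tz lam) mulrCA mulrA.
Qed.

(** * Resultants and common roots of characteristic polynomials *)

Lemma resultant_root (A : idomainType) (F : fieldType) (ev : {rmorphism A -> F})
    (p q : {poly A}) (x : F) :
  (1 < size p)%N -> (1 < size q)%N ->
  root (map_poly ev p) x -> root (map_poly ev q) x -> ev (resultant p q) = 0.
Proof.
(* The resultant is a combination of [p] and [q], both of which vanish at [x] after
   specialization. *)
move=> sp sq /rootP px /rootP qx; have [[u v] _ /= e] := resultant_in_ideal sp sq.
have := congr1 (fun f => (map_poly ev f).[x]) e.
by rewrite /= map_polyC hornerC rmorphD !rmorphM /= hornerD !hornerM px qx !mulr0 addr0.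
Qed.

Lemma horner_char_poly (F : comNzRingType) n (M : 'M[F]_n) x :
  (char_poly M).[x] = \det (x%:M - M).
Proof.
rewrite /char_poly -[LHS]/(horner_eval x _) -det_map_mx; congr (\det _).
apply/matrixP => i j; rewrite !mxE.
by rewrite /= /horner_eval hornerD hornerN hornerC hornerMn hornerX.
Qed.

Lemma charP_char_poly (R : realType) d Q (cA : 'I_Q -> 'I_Q -> laurent R d) z lam :
  charP cA z lam = (-1) ^+ Q * (char_poly (\matrix_(i, j) leval (cA i j) z)).[lam].
Proof.
by rewrite horner_char_poly -detZ scaleN1r opprB.
Qed.

(** [D] is the resultant in lambda of the cleared polynomials. If it is zero, the prime factor [q]
    of P, which has full degree [Q] in lambda, divides both; the cofactors are then free of lambda,
    and monicity makes the two polynomials equal. *)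
Lemma common_root_dichotomy (R : realType) d Q (cA : 'I_Q -> 'I_Q -> laurent R d)
    (N : ('I_d -> R[i]) -> 'M[R[i]]_Q) :
  (0 < Q)%N -> irreducibleL (charP cA) ->
  in_ringL (fun z lam => (char_poly (N z)).[lam]) ->
  let chi z := char_poly (\matrix_(i, j) leval (cA i j) z) in
  (exists2 D : mpring R[i] d, D != 0 & forall z lam mu, torus z ->
     root (chi z) lam -> root (char_poly (N z)) lam -> mpeval (fext z mu) d D = 0) \/
  (forall z, torus z -> chi z = char_poly (N z)).
Proof.
move=> Q0 irr /in_ringL_clear[M2 [p2 p2E]] chi.
have [/in_ringL_clear[M1 [p1' p1'E]] _ _] := irr.
(* The sign turns [charP] into the monic characteristic polynomial. *)
pose p1 : {poly mpring R[i] d} := (-1) ^+ Q * p1'.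
have p1E z (tz : torus z) lam :
    (chi z).[lam] * (\prod_j z j) ^+ M1 = mpeval (fext z lam) d.+1 p1.
  rewrite rmorphM -p1'E // charP_char_poly rmorphXn rmorphN1 mulrA mulrA -exprMn.
  by rewrite mulrNN mulr1 expr1n mul1r.
have [s1 l1] := clear_monic (fun z => char_poly_monic _) (fun z => size_char_poly _) p1E.
have [s2 l2] := clear_monic (fun z => char_poly_monic _) (fun z => size_char_poly _) p2E.
have rootE M (z : 'I_d -> R[i]) lam mu (c : {poly R[i]}) (p : {poly mpring R[i] d}) : torus z ->
    (forall lam, c.[lam] * (\prod_j z j) ^+ M = mpeval (fext z lam) d.+1 p) ->
    root c lam -> root (map_poly (mpeval (fext z mu) d) p) lam.
  by move=> tz cE /rootP c0; apply/rootP;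
     have := mpevalS_fext z lam mu p; rewrite -cE c0 mul0r.
have [D0|D0] := eqVneq (resultant p1 p2) 0; last first.
  left; exists (resultant p1 p2) => // z lam mu tz r1 r2.
  apply: (@resultant_root _ _ _ _ _ lam); rewrite ?s1 ?s2 //.
  - exact: rootE tz (p1E z tz) r1.
  - exact: rootE tz (p2E z tz) r2.
right.
have p1E' z : torus z -> forall lam, charP cA z lam * (\prod_j z j) ^+ M1 =
  mpeval (fext z lam) d.+1 p1' by move=> tz lam; exact: p1'E.
have s1' : size p1' = Q.+1 by rewrite -s1 /p1 -signr_odd mulr_sign; case: odd; rewrite ?size_polyN.
have [|q [r' [qp p1'q r1']]] := @irreducibleL_prime _ _ _ _ p1' irr _ p1E'.
  by rewrite s1'.
pose r := (-1) ^+ Q * r'.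
have p1q : p1 = r * q by rewrite /p1 p1'q mulrA.
have r1 : size r = 1%N by rewrite -r1' /r -signr_odd mulr_sign; case: odd; rewrite ?size_polyN.
have [q0 _ qP] := qp.
have sq : size q = Q.+1.
  have : r != 0 by rewrite -size_poly_gt0 r1.
  by move=> r0; have := s1; rewrite p1q size_mul // r1.
have [t p2q] : divides q p2.
  have : (size (gcdp p1 p2) > 1)%N by rewrite -resultant_eq0 D0.
  set g := gcdp p1 p2 => sg.
  have g0 : g != 0 by rewrite -size_poly_gt0 (ltn_trans _ sg).
  have notC (c : mpring R[i] d) : c != 0 -> ~ divides q c%:P.
    move=> c0 [w cE]; have : size (w * q) = 1%N by rewrite -cE size_polyC c0.
    by move/eqP; rewrite size_mul_eq1 sq => /andP[_ /eqP[Q1]]; rewrite Q1 in Q0.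
  (* Up to a constant, [q] is [h * g]. Since [g] has positive degree, [h] has smaller degree than
     [q], so the prime [q] must divide [g]. *)
  have /Pdiv.Idomain.dvdpP[[c h] /= c0 ghE] : g %| q.
    apply: dvdp_trans (dvdp_gcdl p1 p2) _.
    have /size_poly1P[r0 r00 rE] : size r == 1%N by rewrite r1.
    by rewrite p1q rE mul_polyC dvdpZl.
  have h0 : h != 0.
    apply: contra_neq q0 => h0; have : c *: q == 0 by rewrite ghE h0 mul0r.
    by rewrite scale_poly_eq0 (negbTE c0) => /eqP.
  have qg : divides q g.
    have [||//] := qP h g; first by exists c%:P; rewrite mul_polyC.
    move=> [w hE]; have := congr1 (fun f : {poly _} => size f) ghE.
    rewrite /= size_scale // size_mul //.
    have : (size q <= size h)%N.
      rewrite hE size_mul //; last by apply: contra_neq h0 => w0; rewrite hE w0 mul0r.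
      have : w != 0 by apply: contra_neq h0 => w0; rewrite hE w0 mul0r.
      rewrite -size_poly_gt0; lia.
    lia.
  have /Pdiv.Idomain.dvdpP[[c2 h2] /= c20 e2] : g %| p2 := dvdp_gcdr p1 p2.
  have [||//] := qP c2%:P p2; last by move/notC => /(_ c20).
  by rewrite mul_polyC e2; apply: dividesMr.
have t1 : size t = 1%N.
  have t0 : t != 0.
    by apply/eqP => t0; have := s2; rewrite p2q t0 mul0r size_poly0.
  have := s2; rewrite p2q size_mul // sq addnS /= -addn1 addnC => /eqP.
  by rewrite eqn_add2l => /eqP.
have /size_poly1P[r0 r00 rE] : size r == 1%N by rewrite r1.
have /size_poly1P[t0 t00 tE] : size t == 1%N by rewrite t1.
move=> z tz; apply/eqP; rewrite -subr_eq0; apply/eqP; apply: poly_eq0_off0 => x _.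
rewrite hornerD hornerN; apply/eqP; rewrite subr_eq0; apply/eqP.
pose e := mpeval (fext z 0) d.
have m0 := prod_torus_neq0 tz.
(* Both characteristic polynomials at [x] equal the value of [q] over that of its leading
   coefficient; the comparison is made after multiplying by both monomial powers. *)
have l1e : (\prod_j z j) ^+ M1 = e r0 * e (lead_coef q).
  by rewrite -rmorphM -(mpeval_mon z 0) -rmorphXn -l1 p1q lead_coefM rE lead_coefC.
have l2e : (\prod_j z j) ^+ M2 = e t0 * e (lead_coef q).
  by rewrite -rmorphM -(mpeval_mon z 0) -rmorphXn -l2 p2q lead_coefM tE lead_coefC.
have E1 : (chi z).[x] * (\prod_j z j) ^+ M1 = e r0 * mpeval (fext z x) d.+1 q.
  by rewrite p1E // p1q rmorphM rE (mpevalS_fext _ _ 0 r0%:P) map_polyC hornerC.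
have E2 : (char_poly (N z)).[x] * (\prod_j z j) ^+ M2 = e t0 * mpeval (fext z x) d.+1 q.
  by rewrite p2E // p2q rmorphM tE (mpevalS_fext _ _ 0 t0%:P) map_polyC hornerC.
have n1 : (\prod_j z j) ^+ M1 != 0 by rewrite expf_neq0.
have n2 : (\prod_j z j) ^+ M2 != 0 by rewrite expf_neq0.
apply: (mulIf n1); apply: (mulIf n2).
by rewrite E1 [RHS]mulrAC E2 l1e l2e; ring.
Qed.

(** * Null sets *)

Lemma lebesgue_null_sub (R : realType) d (A B : set 'rV[R]_d) :
  A `<=` B -> lebesgue_null B -> lebesgue_null A.
Proof.
move=> AB nB eps e0; have [lo [hi [lh cov sm]]] := nB eps e0.
by exists lo, hi; split=> //; apply: subset_trans cov.
Qed.

(** The finite family is padded to a sequence by the degenerate box at the origin, of volume 0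
    because d is positive. *)
Lemma lebesgue_null_fin_cover (R : realType) d (S : set 'rV[R]_d) : (0 < d)%N ->
  (forall eps : R, 0 < eps -> exists (I : finType) (lo hi : I -> 'rV[R]_d),
     [/\ forall i j, lo i 0 j <= hi i 0 j, S `<=` \bigcup_i box (lo i) (hi i) &
         \sum_i \prod_(j < d) (hi i 0 j - lo i 0 j) <= eps]) ->
  lebesgue_null S.
Proof.
move=> d0 cov eps e0; have [I [lo [hi [lh Sc sm]]]] := cov eps e0.
pose ext (f : I -> 'rV[R]_d) n := if insub n is Some k then f (@enum_val I I k) else 0.
have extE f (k : 'I_#|I|) : ext f k = f (enum_val k) by rewrite /ext valK.
have ext0 f n : (#|I| <= n)%N -> ext f n = 0 by move=> nI; rewrite /ext insubF // ltnNge nI.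
have extle n j : ext lo n 0 j <= ext hi n 0 j.
  have [nI|nI] := ltnP n #|I|; last by rewrite !ext0.
  by rewrite -[n]/(val (Ordinal nI)) !extE.
exists (ext lo), (ext hi); split=> // [x /Sc[i _ xi]|N].
  by exists (enum_rank i) => //; rewrite !extE enum_rankK.
pose V n := \prod_(j < d) (ext hi n 0 j - ext lo n 0 j).
have V0 n : 0 <= V n by apply: prodr_ge0 => j _; rewrite subr_ge0.
apply: le_trans sm; rewrite -(big_mkord xpredT V).
apply: (@le_trans _ _ (\sum_(0 <= n < #|I| + N) V n)).
  rewrite addnC (@big_cat_nat _ _ _ N 0 (N + _)) //= ?leq_addr //.
  by rewrite lerDl sumr_ge0.
rewrite (@big_cat_nat _ _ _ #|I| 0 (#|I| + N)) //= ?leq_addr //.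
rewrite [X in _ + X]big_nat_cond [X in _ + X]big1 ?addr0; last first.
  move=> n /andP[/andP[nI _] _]; rewrite /V (bigD1 (Ordinal d0)) //= !ext0 //.
  by rewrite subrr mul0r.
rewrite big_mkord [leRHS](eq_bigl (fun i => i \in I)) // [leRHS]big_enum_val.
by apply: ler_sum => k _; rewrite /V !extE.
Qed.

Lemma lebesgue_null0 (R : realType) d : (0 < d)%N -> lebesgue_null (@set0 'rV[R]_d).
Proof.
move=> d0; apply: lebesgue_null_fin_cover => // eps e0.
exists 'I_0, (fun=> 0), (fun=> 0); split=> //.
by rewrite big_ord0 ltW.
Qed.

Lemma sum_half_powers (R : realType) (eps : R) K :
  0 < eps -> \sum_(i < K) eps / 2 ^+ i.+1 <= eps.
Proof.
move=> e0; suff -> : \sum_(i < K) eps / 2 ^+ i.+1 = eps - eps / 2 ^+ K.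
  by rewrite gerBl divr_ge0 ?exprn_ge0 // ltW.
elim: K => [|K IHK]; first by rewrite big_ord0 expr0 divr1 subrr.
by rewrite big_ord_recr /= IHK exprS; field; rewrite expf_neq0 // pnatr_eq0.
Qed.

Lemma lebesgue_null_bigcup (R : realType) d (S : nat -> set 'rV[R]_d) : (0 < d)%N ->
  (forall n, lebesgue_null (S n)) -> lebesgue_null (\bigcup_n S n).
Proof.
move=> d0 nS eps e0.
have /choice[b bP] : forall i, exists b : (nat -> 'rV[R]_d) * (nat -> 'rV[R]_d),
    [/\ forall n j, b.1 n 0 j <= b.2 n 0 j, S i `<=` \bigcup_n box (b.1 n) (b.2 n) &
        forall N, \sum_(n < N) \prod_(j < d) (b.2 n 0 j - b.1 n 0 j) <= eps / 2 ^+ i.+1].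
  move=> i; have [|lo [hi H]] := nS i (eps / 2 ^+ i.+1).
    by rewrite divr_gt0 // exprn_gt0.
  by exists (lo, hi).
(* Boxes are enumerated through codes of pairs; a number coding no pair receives a degenerate
   box. *)
pose ext (f : nat -> nat -> 'rV[R]_d) n :=
  if pickle_inv n is Some x then f x.1 x.2 else 0.
pose lo := ext (fun i => (b i).1); pose hi := ext (fun i => (b i).2).
pose V x := \prod_(j < d) ((b x.1).2 x.2 0 j - (b x.1).1 x.2 0 j).
have V0 x : 0 <= V x.
  by apply: prodr_ge0 => j _; rewrite subr_ge0; have [+ _ _] := bP x.1; apply.
have volE n : \prod_(j < d) (hi n 0 j - lo n 0 j) =
    if pickle_inv n is Some x then V x else 0.
  rewrite /hi /lo /ext; case: pickle_inv => [x //|].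
  by rewrite (bigD1 (Ordinal d0)) //= subrr mul0r.
exists lo, hi; split.
- move=> n j; rewrite /lo /hi /ext; case: pickle_inv => [x|//].
  by have [+ _ _] := bP x.1; apply.
- move=> x [i _ Sx]; have [_ + _] := bP i; move=> /(_ x Sx)[n _ xn].
  by exists (pickle (i, n)) => //; rewrite /lo /hi /ext pickleK_inv.
- move=> N.
  (* [K] is chosen so that every pair with code below [N] has both entries below [K]; the partial
     sum is then at most the double sum over that square. *)
  pose sz n := if @pickle_inv (nat * nat)%type n is Some x then (x.1 + x.2).+1 else 0%N.
  pose K := (\sum_(n < N) sz n)%N.
  apply: (@le_trans _ _ (\sum_(i < K) \sum_(k < K) V (i : nat, k : nat))); last first.
    apply: le_trans (sum_half_powers K e0); apply: ler_sum => i _.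
    by have [_ _] := bP i; apply.
  pose c n (i k : nat) := if pickle (i, k) == n then V (i, k) else 0.
  apply: (@le_trans _ _ (\sum_(n < N) \sum_(i < K) \sum_(k < K) c n i k)).
    apply: ler_sum => n _; rewrite volE.
    have c0 i k : 0 <= c n i k by rewrite /c; case: ifP.
    case E : pickle_inv => [[i k]|]; last by do 2 (apply: sumr_ge0 => ? _).
    have : (sz n <= K)%N by rewrite /K (bigD1 n) //= leq_addr.
    rewrite /sz E /= => ikK.
    have iK : (i < K)%N by apply: leq_trans ikK; rewrite ltnS leq_addr.
    have kK : (k < K)%N by apply: leq_trans ikK; rewrite ltnS leq_addl.
    rewrite (bigD1 (Ordinal iK)) //= (bigD1 (Ordinal kK)) //=.
    have := @pickle_invK (nat * nat)%type n; rewrite E /= => pE.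
    rewrite {1}/c pE eqxx -addrA lerDl addr_ge0 ?sumr_ge0 // => i' _.
    by rewrite sumr_ge0.
  rewrite exchange_big /=; apply: ler_sum => i _.
  rewrite exchange_big /=; apply: ler_sum => k _.
  rewrite /c -big_mkcond /=; have [pN|pN] := ltnP (pickle (i : nat, k : nat)) N.
    by rewrite (big_pred1 (Ordinal pN)) // => n; rewrite /= -val_eqE /= eq_sym.
  rewrite big_pred0 // => n; apply/negbTE; apply: contraTneq (ltn_ord n) => <-.
  by rewrite -leqNgt.
Qed.

Lemma lebesgue_null_bigcup_count (R : realType) d (T : countType)
    (S : T -> set 'rV[R]_d) : (0 < d)%N ->
  (forall t, lebesgue_null (S t)) -> lebesgue_null (\bigcup_t S t).
Proof.
move=> d0 nS.
apply: (@lebesgue_null_sub _ _ _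
  (\bigcup_n (if unpickle n is Some t then S t else set0))).
  by move=> x [t _ Sx]; exists (pickle t) => //; rewrite pickleK.
apply: lebesgue_null_bigcup => // n; case: unpickle => [t|]; first exact: nS.
exact: lebesgue_null0.
Qed.

Lemma lebesgue_nullU (R : realType) d (A B : set 'rV[R]_d) : (0 < d)%N ->
  lebesgue_null A -> lebesgue_null B -> lebesgue_null (A `|` B).
Proof.
move=> d0 nA nB.
apply: (@lebesgue_null_sub _ _ _ (\bigcup_(b : bool) (if b then A else B))).
  by move=> x [?|?]; [exists true | exists false].
by apply: lebesgue_null_bigcup_count => // -[].
Qed.

Lemma grid_cell (R : realType) (v rho x : R) n : 0 < rho -> v <= x <= v + rho ->
  exists i : 'I_n.+1,
    v + i%:R * (rho / n.+1%:R) <= x <= v + i%:R * (rho / n.+1%:R) + rho / n.+1%:R.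
Proof.
move=> r0 /andP[vx xv]; have [xl|xr] := ltP x (v + rho); last first.
  exists ord_max; have -> : x = v + rho by apply/eqP; rewrite eq_le xv xr.
  have -> : v + (@ord_max n)%:R * (rho / n.+1%:R) + rho / n.+1%:R = v + rho.
    by rewrite /= -natr1; field; rewrite natr1 pnatr_eq0.
  rewrite lexx andbT lerD2l /= mulrCA ler_piMr ?(ltW r0) //.
  by rewrite ler_pdivrMr ?ltr0n // mul1r ler_nat.
pose t := (x - v) / (rho / n.+1%:R).
have rn0 : 0 < rho / n.+1%:R by rewrite divr_gt0.
have t0 : 0 <= t by rewrite divr_ge0 ?subr_ge0 // ltW.
have tn : t < n.+1%:R.
  by rewrite ltr_pdivrMr // mulrCA divff ?mulr1 ?pnatr_eq0 //; lra.
have /andP[t1 t2] := truncn_itv t0.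
have ti : (Num.truncn t < n.+1)%N by rewrite -(ltr_nat R) (le_lt_trans t1).
exists (Ordinal ti) => /=; apply/andP; split.
  by rewrite -lerBrDl -ler_pdivlMr.
rewrite -addrA -lerBlDl -[X in _ <= _ + X]mul1r -mulrDl natr1.
by rewrite -ler_pdivrMr // ltW.
Qed.

(* Over a grid of mesh h in the coordinates other than j, each column is covered by a single
   box of height 2 K h. Columns are indexed by all grid indices, those with [g j != 0] getting
   boxes of height 0, so that the total volume is a product of sums. *)
Lemma lebesgue_null_lipschitz_graph (R : realType) d (S : set 'rV[R]_d) (j : 'I_d)
    (v : 'rV[R]_d) (rho K : R) : 0 < rho -> 0 <= K ->
  (forall x, S x -> forall l, v 0 l <= x 0 l <= v 0 l + rho) ->
  (forall x y, S x -> S y -> forall delta, 0 <= delta ->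
     (forall l, l != j -> `|x 0 l - y 0 l| <= delta) -> `|x 0 j - y 0 j| <= K * delta) ->
  lebesgue_null S.
Proof.
move=> r0 K0 Sv SL; apply: lebesgue_null_fin_cover => [|eps e0].
  exact: leq_ltn_trans (ltn_ord j).
(* The boxes have total volume 2 K h rho^(d-1) = 2 K rho^d / (n + 1), which this choice makes at
   most [eps]. *)
pose n := Num.truncn (2 * K * rho ^+ d / eps).
pose h := rho / n.+1%:R.
have h0 : 0 < h by rewrite divr_gt0.
pose I := {ffun 'I_d -> 'I_n.+1}.
pose col (g : I) (x : 'rV[R]_d) :=
  forall l, l != j -> v 0 l + (g l)%:R * h <= x 0 l <= v 0 l + (g l)%:R * h + h.
(* A reference point of [S] in the column, around which its box is centred in direction [j]; 0 if
   the column misses [S]. *)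
pose y (g : I) := xget 0 (S `&` col g).
pose w (g : I) := if g j == 0 then K * h else 0.
have w0 g : 0 <= w g by rewrite /w; case: ifP => // _; rewrite mulr_ge0 // ltW.
exists I, (fun g => \row_l if l == j then y g 0 j - w g else v 0 l + (g l)%:R * h),
  (fun g => \row_l if l == j then y g 0 j + w g else v 0 l + (g l)%:R * h + h).
split.
- move=> g l; rewrite !mxE; case: eqP => _; last by rewrite lerDl ltW.
  by have := w0 g; lra.
- move=> x Sx.
  have /choice[g0 g0P] : forall l, exists i : 'I_n.+1,
      v 0 l + i%:R * h <= x 0 l <= v 0 l + i%:R * h + h.
    by move=> l; apply: grid_cell => //; apply: Sv.
  pose g : I := [ffun l => if l == j then 0 else g0 l].
  have colx : col g x by move=> l lj; rewrite /g ffunE (negbTE lj); apply: g0P.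
  exists g => // l; rewrite !mxE; case: eqP => [->|/eqP lj]; last exact: colx.
  have [Sy coly] : (S `&` col g) (y g) by apply: xgetPex; exists x.
  have wE : w g = K * h by rewrite /w /g ffunE eqxx.
  suff : `|x 0 j - y g 0 j| <= K * h by rewrite ler_norml wE => /andP[]; lra.
  apply: SL => // [|l' lj']; first exact: ltW.
  have := colx l' lj'; have := coly l' lj'; rewrite ler_norml.
  by move=> /andP[? ?] /andP[? ?]; apply/andP; split; lra.
pose F l (i : 'I_n.+1) := if l == j then (if i == 0 then 2 * (K * h) else 0) else h.
rewrite (eq_bigr (fun g : I => \prod_l F l (g l))); last first.
  move=> g _; apply: eq_bigr => l _; rewrite !mxE /F /w; case: eqP => [->|_]; last by ring.
  by case: ifP => _; ring.
(* The sum of products becomes a product of sums: direction [j] gives 2 K h, every other direction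
   (n + 1) h = rho. *)
rewrite -bigA_distr_bigA /= (bigD1 j) //= [X in X * _](_ : _ = 2 * (K * h)); last first.
  rewrite (bigD1 ord0) //= /F !eqxx big1 ?addr0 // => i i0.
  by rewrite (negbTE i0).
rewrite [X in _ * X](_ : _ = rho ^+ d.-1); last first.
  rewrite (eq_bigr (fun=> rho)) => [|l lj].
    by rewrite prodr_const cardC1 card_ord.
  rewrite /F (negbTE lj) sumr_const card_ord -mulr_natr /h divfK // pnatr_eq0 //.
have -> : 2 * (K * h) * rho ^+ d.-1 = 2 * K * rho ^+ d / n.+1%:R.
  have -> : rho ^+ d = rho * rho ^+ d.-1.
    by rewrite -exprS prednK //; apply: leq_ltn_trans (ltn_ord j).
  by rewrite /h; ring.
rewrite ler_pdivrMr ?ltr0n // [leRHS]mulrC -ler_pdivrMr //.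
by apply: ltW; apply: truncnS_gt.
Qed.

(** Countably many cubes of side [rho] cover the space, and inside each the local estimate holds for
    all pairs of points. *)
Lemma lebesgue_null_local_lipschitz (R : realType) d (S : set 'rV[R]_d) (j : 'I_d)
    (rho K : R) : 0 < rho -> 0 <= K ->
  (forall x y, S x -> S y -> (forall l, `|x 0 l - y 0 l| <= rho) ->
     forall delta, 0 <= delta ->
     (forall l, l != j -> `|x 0 l - y 0 l| <= delta) -> `|x 0 j - y 0 j| <= K * delta) ->
  lebesgue_null S.
Proof.
move=> r0 K0 SL.
pose v (g : {ffun 'I_d -> int}) : 'rV[R]_d := \row_l ((g l)%:~R * rho).
pose cube g := [set x : 'rV[R]_d | forall l, v g 0 l <= x 0 l <= v g 0 l + rho].
apply: (@lebesgue_null_sub _ _ _ (\bigcup_g (S `&` cube g))).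
  move=> x Sx; exists [ffun l => Num.floor (x 0 l / rho)] => //; split=> // l.
  rewrite !mxE ffunE; have /andP[f1 f2] := floor_itv (x 0 l / rho).
  apply/andP; split; first by rewrite -ler_pdivlMr.
  rewrite -[X in _ + X]mul1r -mulrDl -ler_pdivrMr // ltW //.
  by rewrite intrD in f2.
apply: lebesgue_null_bigcup_count => [|g]; first exact: leq_ltn_trans (ltn_ord j).
apply: (@lebesgue_null_lipschitz_graph _ _ _ j (v g) rho K) => //.
  by move=> x [_ xg].
move=> x y [Sx xg] [Sy yg]; apply: SL => // l.
have := xg l; have := yg l; rewrite ler_norml.
by move=> /andP[? ?] /andP[? ?]; apply/andP; split; lra.
Qed.

(** * Bounds for polynomials on the closed unit polydisc *)

Lemma normc_ge0 (R : rcfType) (x : R[i]) : 0 <= normc x.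
Proof. by case: x => a b; apply: sqrtr_ge0. Qed.

Lemma normcD_le (R : rcfType) (x y : R[i]) : normc (x + y) <= normc x + normc y.
Proof. exact: le_normcD. Qed.

Lemma normc_opp (R : rcfType) (x : R[i]) : normc (- x) = normc x.
Proof. exact: normcN. Qed.

Definition bounded_pt (R : realType) (z : nat -> R[i]) : Prop := forall i, normc (z i) <= 1.

Lemma mpoly_bound (R : realType) n (p : {poly mpring R[i] n}) :
  (forall c : mpring R[i] n, exists2 B : R, 0 <= B & forall z, bounded_pt z ->
     normc (mpeval z n c) <= B) ->
  exists2 B : R, 0 <= B & forall z x, bounded_pt z -> normc x <= 1 ->
     normc (map_poly (mpeval z n) p).[x] <= B.
Proof.
move=> bn; elim/poly_ind: p => [|p c [B B0 pB]].
  by exists 0 => // z x _ _; rewrite rmorph0 horner0 normc0.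
have [B' B'0 cB'] := bn c; exists (B + B'); first exact: addr_ge0.
move=> z x zb xb; rewrite rmorphD rmorphM /= map_polyX map_polyC hornerMXaddC.
apply: le_trans (normcD_le _ _) _; apply: lerD; last exact: cB'.
rewrite normcM -[leRHS]mulr1; apply: ler_pM => //; rewrite ?normc_ge0 //.
exact: pB.
Qed.

Lemma mpeval_bound (R : realType) n (c : mpring R[i] n) :
  exists2 B : R, 0 <= B & forall z, bounded_pt z -> normc (mpeval z n c) <= B.
Proof.
elim: n c => [|n IHn] c; first by exists (normc c) => //; apply: normc_ge0.
have [B B0 cB] := mpoly_bound c IHn.
by exists B => // z zb; rewrite mpevalS; apply: cB.
Qed.

Lemma mpeval_lipschitz (R : realType) n (c : mpring R[i] n) :
  exists2 L : R, 0 <= L & forall z w delta, bounded_pt z -> bounded_pt w ->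
    0 <= delta -> (forall i, (i < n)%N -> normc (z i - w i) <= delta) ->
    normc (mpeval z n c - mpeval w n c) <= L * delta.
Proof.
elim: n c => [|n IHn] c.
  by exists 0 => // z w delta _ _ _ _; rewrite subrr normc0 mul0r.
elim/poly_ind: c => [|p c [L L0 pL]].
  by exists 0 => // z w delta _ _ _ _; rewrite !rmorph0 subrr normc0 mul0r.
have [L' L'0 cL'] := IHn c; have [B B0 pB] := @mpeval_bound R n.+1 p.
exists (L + B + L'); first by rewrite !addr_ge0.
move=> z w delta zb wb d0 zw.
have := pL z w delta zb wb d0 zw.
have := cL' z w delta zb wb d0 (fun i il => zw i (ltnW il)).
have := pB z zb; have := zw n (ltnSn n); have := wb n.
rewrite !mpevalS !rmorphD !rmorphM /= !map_polyX !map_polyC !hornerMXaddC.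
set P := _.[z n]; set P' := _.[w n]; set c1 := mpeval z n c; set c2 := mpeval w n c.
move=> wn znwn PB cL PL.
have -> : P * z n + c1 - (P' * w n + c2) = P * (z n - w n) + (P - P') * w n + (c1 - c2).
  by ring.
apply: le_trans (normcD_le _ _) _; rewrite [leRHS]mulrDl lerD //.
apply: le_trans (normcD_le _ _) _; rewrite [L + B]addrC [leRHS]mulrDl lerD //.
  by rewrite normcM ler_pM ?normc_ge0.
by rewrite normcM -[leRHS]mulr1 ler_pM ?normc_ge0.
Qed.

Lemma mpoly_taylor (R : realType) n (p : {poly mpring R[i] n}) :
  exists2 B : R, 0 <= B & forall z x y, bounded_pt z -> normc x <= 1 -> normc y <= 1 ->
    normc ((map_poly (mpeval z n) p).[y] - (map_poly (mpeval z n) p).[x]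
           - (y - x) * (map_poly (mpeval z n) (deriv p)).[x]) <= B * normc (y - x) ^+ 2.
Proof.
elim/poly_ind: p => [|p c [B B0 pB]].
  exists 0 => // z x y _ _ _.
  by rewrite -{3}polyC0 derivC !rmorph0 !horner0 !(mulr0, subrr) normc0 mul0r.
have [B' B'0 pB'] := @mpoly_bound R n (deriv p) (@mpeval_bound R n).
exists (B + B'); first exact: addr_ge0.
move=> z x y zb xb yb; have := pB z x y zb xb yb; have := pB' z x zb xb.
rewrite derivD derivM derivX derivC addr0 mulr1 !rmorphD !rmorphM /=.
rewrite !map_polyX !map_polyC !hornerD !hornerM !hornerX !hornerC.
set P := map_poly _ p; set P' := map_poly _ (deriv p); set c' := mpeval z n c => P'B PB.
(* The remainder for [p * 'X + c] is [y] times that for [p], plus a term already quadratic in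
   [y - x]. *)
have -> : P.[y] * y + c' - (P.[x] * x + c') - (y - x) * (P'.[x] * x + P.[x]) =
   y * (P.[y] - P.[x] - (y - x) * P'.[x]) + (y - x) ^+ 2 * P'.[x] by ring.
apply: le_trans (normcD_le _ _) _; rewrite [leRHS]mulrDl lerD //.
  by rewrite normcM -[leRHS]mul1r ler_pM ?normc_ge0.
by rewrite normcM expr2 normcM -expr2 mulrC ler_wpM2r // exprn_ge0 // normc_ge0.
Qed.

(** * The circle map is locally bi-Lipschitz *)

Lemma cos_sub1_sin_le (R : realType) (t : R) : `|cos t - 1| <= `|t| /\ `|sin t| <= `|t|.
Proof.
wlog t0 : t / 0 < t => [H|].
  have [t0|t0|->] := ltgtP t 0; last by rewrite cos0 sin0 subrr normr0.
    have := H (- t); rewrite oppr_gt0 t0 cosN sinN !normrN; exact.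
  exact: H.
split.
  have [|c _] := @MVT R cos (fun x => - sin x) 0 t t0.
    by apply: continuous_subspaceT; apply: continuous_cos.
  rewrite cos0 subr0 => ->; rewrite normrM normrN ler_piMl //.
  by rewrite ler_norml sin_geN1 sin_le1.
have [|c _] := @MVT R sin cos 0 t t0.
  by apply: continuous_subspaceT; apply: continuous_sin.
rewrite sin0 !subr0 => ->; rewrite normrM ler_piMl //.
by rewrite ler_norml cos_geN1 cos_le1.
Qed.

(** By the mean value theorem the ratio is a cosine at some c in (0, 1/2), and cos c >= 1 - c >=
    1/2. *)
Lemma sin_ge_half (R : realType) (t : R) : `|t| <= 2^-1 -> `|t| / 2 <= `|sin t|.
Proof.
wlog t0 : t / 0 < t => [H|].
  have [t0|t0|->] := ltgtP t 0; last by rewrite sin0 !normr0 mul0r.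
    have := H (- t); rewrite oppr_gt0 t0 sinN !normrN; exact.
  exact: H.
rewrite (gtr0_norm t0) => t2.
have [|c] := @MVT R sin cos 0 t t0.
  by apply: continuous_subspaceT; apply: continuous_sin.
rewrite in_itv /= => /andP[c0 ct]; rewrite sin0 !subr0 => ->.
have [+ _] := cos_sub1_sin_le c; rewrite (gtr0_norm c0) ler_norml => /andP[+ _] => H.
rewrite normrM (gtr0_norm t0) mulrC ler_pM2r //.
by apply: le_trans (ler_norm _); lra.
Qed.

Lemma normc_expi2pi (R : realType) (t : R) : normc (expi2pi t) = 1.
Proof. by rewrite /expi2pi /= cos2Dsin2 sqrtr1. Qed.

Lemma expi2piD (R : realType) (s t : R) : expi2pi (s + t) = expi2pi s * expi2pi t.
Proof.
rewrite /expi2pi mulrDr cosD sinD; apply/eqP; rewrite eq_complex /=.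
by rewrite eqxx /= addrC.
Qed.

Lemma expi2pi_sub (R : realType) (s t : R) :
  normc (expi2pi s - expi2pi t) = normc (expi2pi (s - t) - 1).
Proof.
have {1}-> : s = (s - t) + t by rewrite subrK.
by rewrite expi2piD -{2}[expi2pi t]mul1r -mulrBl normcM normc_expi2pi mulr1.
Qed.

Lemma expi2pi_lipschitz (R : realType) (s t : R) :
  normc (expi2pi s - expi2pi t) <= (4 * pi) * `|s - t|.
Proof.
rewrite expi2pi_sub /expi2pi; set u := s - t.
have [cu su] := cos_sub1_sin_le (2 * pi * u).
have p0 := pi_gt0 R.
have e : `|2 * pi * u| = 2 * pi * `|u| by rewrite normrM gtr0_norm //; lra.
rewrite e in cu su.
have -> : 4 * pi * `|u| = `|4 * pi * `|u| | by rewrite [RHS]ger0_norm // !mulr_ge0 // ltW.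
rewrite -sqrtr_sqr /= ler_sqrt ?sqr_ge0 // subr0.
have -> : (cos (2 * pi * u) - 1) ^+ 2 = `|cos (2 * pi * u) - 1| ^+ 2.
  by rewrite real_normK ?num_real.
have -> : sin (2 * pi * u) ^+ 2 = `|sin (2 * pi * u)| ^+ 2 by rewrite real_normK ?num_real.
have := normr_ge0 (cos (2 * pi * u) - 1); have := normr_ge0 (sin (2 * pi * u)).
nra.
Qed.

(** The imaginary part of [expi2pi (s - t) - 1] already suffices; the radius keeps its angle within
    1/2, as [sin_ge_half] requires. *)
Lemma expi2pi_expansive (R : realType) (s t : R) : `|s - t| <= (4 * pi)^-1 ->
  pi * `|s - t| <= normc (expi2pi s - expi2pi t).
Proof.
rewrite expi2pi_sub /expi2pi; set u := s - t => us.
have p0 := pi_gt0 R.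
have e : `|2 * pi * u| = 2 * pi * `|u| by rewrite normrM gtr0_norm //; lra.
have := @sin_ge_half R (2 * pi * u); rewrite e => H.
apply: (@le_trans _ _ `|sin (2 * pi * u)|).
  apply: le_trans (H _); first by lra.
  have half q : 0 < q -> 2^-1 = 2 * q * (4 * q)^-1 :> R.
    by move=> q0; field; rewrite gt_eqF.
  rewrite (half _ p0).
  by rewrite ler_pM2l // mulr_gt0.
rewrite -sqrtr_sqr /= ler_sqrt ?addr_ge0 ?sqr_ge0 // subr0.
by rewrite lerDr sqr_ge0.
Qed.

(** * Zero sets on the real torus *)

Definition bloch_pt (R : realType) d (k : 'rV[R]_d) : nat -> R[i] :=
  fext (fun l => expi2pi (k 0 l)) 1.

Lemma bloch_pt_bounded (R : realType) d (k : 'rV[R]_d) : bounded_pt (bloch_pt k).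
Proof.
by move=> i; rewrite /bloch_pt /fext; case: insub => [j|]; rewrite ?normc_expi2pi ?normc1.
Qed.

(* Away from the zeros of the derivative in its last coordinate, the zero set is locally
   a Lipschitz graph over the other coordinates. *)
Lemma simple_zeros_null (R : realType) d n (p : {poly mpring R[i] n})
    (nd : (n < d)%N) (eta : R) :
  0 < eta ->
  lebesgue_null [set k : 'rV[R]_d | mpeval (bloch_pt k) n.+1 p = 0 /\
                           eta <= normc (mpeval (bloch_pt k) n.+1 (deriv p))].
Proof.
move=> eta0; have [L L0 pL] := @mpeval_lipschitz R n.+1 p.
have [B B0 pB] := @mpoly_taylor R n p.
have p0 := pi_gt0 R.
pose j := Ordinal nd.
(* The first bound serves [expi2pi_expansive]; the second makes the quadratic Taylor term at most
   half of the linear one. *)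
pose rho := Num.min (4 * pi)^-1 (eta / (2 * (B * (4 * pi) + 1))).
have Bp : 0 < 2 * (B * (4 * pi) + 1).
  by rewrite mulr_gt0 // ltr_wpDl // !mulr_ge0 // ltW.
have r0 : 0 < rho by rewrite lt_min invr_gt0 mulr_gt0 // divr_gt0.
pose K := 2 * L * (4 * pi) / (eta * pi).
apply: (@lebesgue_null_local_lipschitz _ _ _ j rho K) => //.
  by rewrite divr_ge0 ?mulr_ge0 // ltW.
move=> x y [px dpx] [py _] xy delta d0 xyd.
have rhoE : rho <= (4 * pi)^-1 /\ rho <= eta / (2 * (B * (4 * pi) + 1)).
  by split; rewrite ge_min lexx ?orbT.
pose ex := bloch_pt x; pose ey := bloch_pt y.
have ptE (k : 'rV[R]_d) (l : 'I_d) : bloch_pt k l = expi2pi (k 0 l) by rewrite /bloch_pt fext_ord.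
pose X := ex n; pose Y := ey n.
have XE : X = expi2pi (x 0 j) := ptE x j.
have YE : Y = expi2pi (y 0 j) := ptE y j.
pose u := normc (Y - X).
have u_lo : pi * `|x 0 j - y 0 j| <= u.
  rewrite /u XE YE distrC; apply: expi2pi_expansive; rewrite distrC.
  by apply: le_trans (xy j) _; case: rhoE.
have u_hi : u <= (4 * pi) * rho.
  rewrite /u XE YE; apply: le_trans (expi2pi_lipschitz _ _) _.
  by rewrite ler_pM2l ?mulr_gt0 // distrC.
(* A hybrid point with the last coordinate of [y] and the others of [x]. It differs from [y], a zero
   of [p], only in the earlier coordinates, so [p] there is of order [delta]; it differs from [x]
   only in the last one, where Taylor's formula applies. *)
pose z i := if i == n then Y else ex i.
have zb : bounded_pt z by move=> i; rewrite /z; case: eqP => _; apply: bloch_pt_bounded.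
have PY : normc (map_poly (mpeval ex n) p).[Y] <= L * (4 * pi * delta).
  have -> : (map_poly (mpeval ex n) p).[Y] = mpeval z n.+1 p - mpeval ey n.+1 p.
    rewrite py subr0 mpevalS /z eqxx; congr (_ .[_]); apply: eq_map_poly => c.
    by apply: mpeval_ext => i; case: ltngtP.
  apply: pL => //; first exact: bloch_pt_bounded.
    by rewrite !mulr_ge0 // ltW.
  move=> i; rewrite ltnS /z; case: eqP => [-> _|/eqP ne le_in].
    by rewrite subrr normc0 !mulr_ge0 // ltW.
  have id : (i < d)%N := leq_ltn_trans le_in nd.
  rewrite /ex /ey (_ : i = Ordinal id :> nat) // !ptE.
  apply: le_trans (expi2pi_lipschitz _ _) _.
  by rewrite ler_pM2l ?mulr_gt0 // xyd // -val_eqE.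
have := pB ex X Y (bloch_pt_bounded x) (bloch_pt_bounded x n) (bloch_pt_bounded y n).
rewrite -mpevalS px subr0 -mpevalS -/u => T.
have uD : u * eta <= L * (4 * pi * delta) + B * u ^+ 2.
  apply: (@le_trans _ _ (normc ((Y - X) * mpeval ex n.+1 (deriv p)))).
    by rewrite normcM ler_wpM2l ?normc_ge0.
  set P := (map_poly _ p).[Y] in PY T *; set W := _ * _ in T *.
  have -> : W = P - (P - W) by ring.
  by apply: le_trans (normcD_le _ _) _; rewrite normc_opp lerD.
have u0 : 0 <= u := normc_ge0 _.
have Bu : B * u <= eta / 2.
  apply: (@le_trans _ _ (B * (4 * pi * rho))); first by rewrite ler_wpM2l.
  have [_] := rhoE; rewrite ler_pdivlMr // => rB.
  have : 0 <= rho by exact: ltW.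
  nra.
(* By [Bu] the quadratic term is at most [u * eta / 2] and is absorbed on the left; with [u_lo] this
   gives the constant [K]. *)
have F : u * eta <= 2 * (L * (4 * pi * delta)) by nra.
rewrite /K [leRHS]mulrAC ler_pdivlMr ?mulr_gt0 //; nra.
Qed.

Lemma zeros_null (R : realType) d n (p : mpring R[i] n) : (0 < d)%N -> (n <= d)%N -> p != 0 ->
  lebesgue_null [set k : 'rV[R]_d | mpeval (bloch_pt k) n p = 0].
Proof.
move=> d0; elim: n p => [|n IHn] p nd p0.
  by apply: (lebesgue_null_sub _ (lebesgue_null0 d0)) => k /= /eqP; rewrite (negbTE p0).
move: p p0; suff H m : forall p : {poly mpring R[i] n}, (size p < m)%N -> p != 0 ->
    lebesgue_null [set k : 'rV[R]_d | mpeval (bloch_pt k) n.+1 p = 0].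
  by move=> p; apply: (H (size (p : {poly mpring R[i] n})).+1).
elim: m => // m IHm p sp p0; have [s1|s1] := leqP (size p) 1.
  have /size_poly1P[c c0 ->] : size p == 1%N by rewrite eqn_leq s1 size_poly_gt0.
  apply: (lebesgue_null_sub _ (IHn c (ltnW nd) c0)) => k.
  by rewrite /mkset mpevalS map_polyC hornerC.
have dp0 : deriv p != 0.
  apply/eqP => dp0; case sE : (size p) s1 => [//|[//|i]] _.
  have /eqP := congr1 (fun f : {poly mpring R[i] n} => f`_i) dp0.
  rewrite coef_deriv coef0 -mulr_natr mulf_eq0 => /orP[|/eqP n0].
    by apply/negP; have := lead_coef_eq0 p; rewrite lead_coefE sE /= => ->.
  have := congr1 (mpeval (fun=> 0) n) n0; rewrite rmorph0 rmorph_nat => /eqP.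
  by rewrite pnatr_eq0.
(* Zeros shared with the derivative fall under the induction on degree; at the others the derivative
   has modulus at least 1/(i+1) for some i. *)
apply: (@lebesgue_null_sub _ _ _
  ([set k | mpeval (bloch_pt k) n.+1 (deriv p) = 0] `|`
   \bigcup_i [set k | mpeval (bloch_pt k) n.+1 p = 0 /\
                      i.+1%:R^-1 <= normc (mpeval (bloch_pt k) n.+1 (deriv p))])).
  move=> k /= pk; have [dk|dk] := eqVneq (mpeval (bloch_pt k) n.+1 (deriv p)) 0.
    by left.
  right; set D := mpeval _ _ _ in dk *.
  have D0 : 0 < normc D.
    by rewrite lt_def normc_ge0 andbT; apply: contra dk => /eqP/eq0_normc/eqP.
  exists (Num.truncn (normc D)^-1) => //; split=> //.
  rewrite -[leRHS]invrK lef_pV2 ?posrE ?invr_gt0 ?ltr0n //.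
  by apply: ltW; apply: truncnS_gt.
apply: lebesgue_nullU => //.
  apply: IHm => //; apply: leq_trans (lt_size_deriv p0) _; exact: sp.
apply: lebesgue_null_bigcup => // i; apply: simple_zeros_null => //.
Qed.

(** * Eigenvalues *)

(** For a left eigenvector v, the form v M v^* equals x |v|^2 and is its own conjugate, while |v|^2
    is real and nonzero. *)
Lemma hermitian_eigenvalue_real (R : realType) Q (M : 'M[R[i]]_Q) (x : R[i]) :
  hermitian_mx M -> root (char_poly M) x -> x \is Num.real.
Proof.
move=> hM; rewrite -eigenvalue_root_char => /eigenvalueP[v vM v0].
pose s := \sum_j v 0 j * (v 0 j)^*.
have s0 : s != 0.
  apply: contra_neq v0 => s0; apply/rowP => j; rewrite mxE; apply/eqP.
  rewrite -normr_eq0 -sqrf_eq0 normCK.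
  have /psumr_eq0P : forall i : 'I_Q, true -> 0 <= v 0 i * (v 0 i)^*.
    by move=> i _; apply: mul_conjC_ge0.
  by move=> /(_ s0 j isT) ->.
pose S := \sum_j \sum_i v 0 i * M i j * (v 0 j)^*.
have SE : S = x * s.
  rewrite /S /s mulr_sumr; apply: eq_bigr => j _; rewrite -mulr_suml mulrA.
  by congr (_ * _); move/rowP/(_ j): vM; rewrite !mxE.
have SJ : S^* = S.
  rewrite /S rmorph_sum [RHS]exchange_big /=; apply: eq_bigr => j _.
  rewrite rmorph_sum; apply: eq_bigr => i _.
  by rewrite !rmorphM /= conjCK -hM mulrAC [_^* * _]mulrC mulrAC.
apply/CrealP; apply: (mulIf s0); rewrite -SE -SJ SE rmorphM /=; congr (_ * _).
rewrite rmorph_sum; apply: eq_bigr => j _.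
by rewrite rmorphM /= conjCK mulrC.
Qed.

(** Guarantees that [xget] in [eigval] returns a genuine list of eigenvalues and not its default. *)
Lemma sorted_eigs_exists (R : realType) Q (M : 'M[R[i]]_Q) :
  hermitian_mx M -> exists l, sorted_eigs M l.
Proof.
move=> hM; have [r] := closed_field_poly_normal (char_poly M).
rewrite (monicP (char_poly_monic M)) scale1r => rE.
have rR x : x \in r -> (complex.Re x)%:C%C = x.
  move=> xr; apply: RRe_real; apply: (hermitian_eigenvalue_real hM).
  by rewrite rE root_prod_XsubC.
exists (sort <=%R (map (@complex.Re R) r)); split.
- rewrite size_sort size_map; apply/eqP; rewrite -eqSS -(size_char_poly M) rE.
  by rewrite size_prod_XsubC.
- exact: sort_le_sorted.
- rewrite rE (perm_big (map (@complex.Re R) r)) /=; last by rewrite perm_sort.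
  by rewrite big_map; apply: eq_big_seq => x /rR ->.
Qed.

Lemma root_eigval (R : realType) Q (M : 'M[R[i]]_Q) (s : 'I_Q) :
  hermitian_mx M -> root (char_poly M) ((eigval M s)%:C)%C.
Proof.
move=> /sorted_eigs_exists exl; rewrite /eigval.
have [sl _ ->] := xgetPex [::] exl.
rewrite -(big_map (fun x : R => x%:C%C) xpredT (fun x => 'X - x%:P)) root_prod_XsubC.
by rewrite map_f // mem_nth // sl.
Qed.

(** * Boundedness of the trace and conclusion *)

Lemma normc_leval_le (R : realType) d (p : laurent R d) (k : 'rV[R]_d) :
  normc (leval p (fun l => expi2pi (k 0 l))) <= \sum_(t <- p) normc t.1.
Proof.
rewrite /leval; elim: p => [|t p IHp]; first by rewrite !big_nil normc0.
rewrite !big_cons; apply: le_trans (normcD_le _ _) _; apply: lerD => //.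
rewrite normcM (_ : normc (\prod_j _) = 1) ?mulr1 //.
apply: (big_ind (fun x => normc x = 1)) => [|x y x1 y1|j _]; first exact: normc1.
  by rewrite normcM x1 y1 mulr1.
have n1 n : normc (expi2pi (k 0 j) ^+ n) = 1.
  elim: n => [|n IHn]; first by rewrite expr0 normc1.
  by rewrite exprS normcM IHn normc_expi2pi mulr1.
by case: (t.2 j) => n; rewrite ?NegzE /= ?normcV n1 ?invr1.
Qed.

Theorem theorem2 (R : realType) (d Q : nat) (hd : (0 < d)%N) (hQ : (0 < Q)%N)
  (cA : 'I_Q -> 'I_Q -> laurent R d)
  (herm : forall k : 'rV[R]_d, hermitian_mx (symb cA k))
  (irr : irreducibleL (charP cA))
  (a : R) (ha : a != 0) (alpha : 'rV[R]_d) :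
  lebesgue_null
    [set k : 'rV[R]_d | exists s w : 'I_Q,
       eigval (symb cA (k + alpha)) s = eigval (symb cA k) w + a].
Proof.
pose mu (l : 'I_d) := expi2pi (alpha 0 l).
have expi0 x : @expi2pi R x != 0.
  apply/eqP => e0; have := normc_expi2pi x; rewrite e0 normc0 => /eqP.
  by rewrite eq_sym oner_eq0.
pose A z := \matrix_(i, j) leval (cA i j) z.
(* Subtracting [a] from the diagonal encodes the shift: the characteristic polynomial of [N z] at
   lambda is that of A(mu z) at lambda + a. *)
pose N z := A (fun l => mu l * z l) - (a%:C%C)%:M.
pose e (k : 'rV[R]_d) l := expi2pi (k 0 l).
have te k : torus (e k) by move=> l; apply: expi0.
have eD k : (fun l => mu l * e k l) = e (k + alpha).
  by apply/funext => l; rewrite /e mxE expi2piD mulrC.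
have AE k : A (e k) = symb cA k by [].
have shiftN z lam : (char_poly (N z)).[lam] = (char_poly (A (fun l => mu l * z l))).[lam + a%:C%C].
  by rewrite !horner_char_poly /N opprB [in RHS]raddfD /= addrA addrAC.
have NinR : in_ringL (fun z lam => (char_poly (N z)).[lam]).
  have [chR _ _] := irr.
  apply: in_ringL_eq (in_ringL_monoM ((-1) ^+ Q) [ffun=> 0] 0
    (in_ringL_shift (a%:C%C) (mu := mu) _ chR)) => [z tz lam|l]; last exact: expi0.
  rewrite shiftN charP_char_poly big1 => [|j _]; last by rewrite ffunE expr0z.
  by rewrite !mulr1 mulrA -exprMn mulrNN mulr1 expr1n mul1r.
have [[D D0 DP]|chiE] := common_root_dichotomy hQ irr NinR.
  apply: lebesgue_null_sub (zeros_null hd (leqnn d) D0) => k /= [s [w sw]].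
  (* The common root is the eigenvalue of index [w] at [k], which becomes the one of index [s] at
     [k + alpha] after adding [a]. *)
  apply: (DP (e k) ((eigval (symb cA k) w)%:C)%C) => //.
    by rewrite -/(A _) AE root_eigval.
  apply/rootP; rewrite shiftN eD -rmorphD /= -sw; apply/rootP.
  exact: root_eigval (herm _).
have [t tE] : exists t : 'rV[R]_d -> R[i], forall k, t k = \tr (A (e k)) by eexists.
have trE k : t (k + alpha) = t k + a%:C%C *+ Q.
  (* The coefficient of degree [Q.-1] is minus the trace. *)
  have E : (char_poly (A (e k)))`_Q.-1 = (char_poly (N (e k)))`_Q.-1.
    by rewrite /A chiE.
  have trA : - \tr (A (e k)) = - \tr (N (e k)).
    by rewrite -(char_poly_trace (A (e k)) hQ) E (char_poly_trace (N (e k)) hQ).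
  have trN : \tr (N (e k)) = t (k + alpha) - a%:C%C *+ Q.
    by rewrite /N eD linearB tE; congr (_ - _); apply: mxtrace_scalar.
  by apply/esym/eqP; rewrite eq_sym -subr_eq -trN tE; apply/eqP/esym; apply: oppr_inj.
have trn n : t (alpha *+ n) = t 0 + a%:C%C *+ (Q * n).
  elim: n => [|n IHn]; first by rewrite muln0 addr0.
  by rewrite mulrSr trE IHn mulnS mulrnDr -addrA [_ *+ Q + _]addrC.
pose T := \sum_i \sum_(t <- cA i i) normc t.1.
have trT k : normc (t k) <= T.
  rewrite tE /mxtrace /T.
  apply: (big_ind2 (fun (x : R[i]) (y : R) => normc x <= y)) => [|x y x' y' xy xy'|i _].
  - by rewrite normc0.
  - by apply: le_trans (normcD_le _ _) _; apply: lerD.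
  - by rewrite mxE; apply: normc_leval_le.
(* With n + 1 > 2 T / |a|, the increment Q (n + 1) a of the trace from 0 to (n + 1) alpha exceeds 2
   T in modulus, while both traces are bounded by [T]. *)
exfalso; pose n := Num.truncn (2 * T / `|a|).
have na : 0 < `|a| by rewrite normr_gt0.
have : `|a| * (Q * n.+1)%:R <= 2 * T.
  have -> : `|a| * (Q * n.+1)%:R = normc (a%:C%C *+ (Q * n.+1)).
    by rewrite normcMn /= expr0n /= addr0 sqrtr_sqr mulr_natr.
  have -> : a%:C%C *+ (Q * n.+1) = t (alpha *+ n.+1) - t 0.
    by rewrite trn addrAC subrr add0r.
  apply: le_trans (normcD_le _ _) _; rewrite normc_opp mulr2n mulrDl mul1r.
  by apply: lerD; apply: trT.
rewrite mulrC -ler_pdivlMr // leNgt => /negP; apply.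
apply: lt_le_trans (truncnS_gt _) _.
by rewrite ler_nat leq_pmull.
Qed.
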